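(* Let $a,b,c$ be real numbers such that $$1-a-b-c>0,\quad 1-a+b+c>0,\quad 1+a-b+c>0,\quad 1+a+b-c>0.$$ Let $X=\{X_{i,j},\ i,j\in\mathbb{Z}\}$ be a wide-sense stationary field and $\epsilon=\{\epsilon_{i,j},\ i,j\in\mathbb{Z}\}$ be a collection of uncorrelated zero-mean equal-variance random variables, $\operatorname{var}\epsilon_{i,j}=\sigma_\epsilon^2\in(0,\infty)$, that satisfy $$X_{i,j}=aX_{i-1,j}+bX_{i,j-1}+cX_{i-1,j-1}+\epsilon_{i,j}\qquad\text{for all } i,j\in\mathbb{Z}.$$ Then $\operatorname{cov}(X_{i,j},\epsilon_{k,l})=0$ if $k>i$ or $l>j$, and the following Yule--Walker equations hold: $$\gamma_X(0,0)=a\gamma_X(1,0)+b\gamma_X(0,1)+c\gamma_X(1,1)+\sigma_\epsilon^2,$$ and $$\gamma_X(h_1,h_2)=a\gamma_X(h_1-1,h_2)+b\gamma_X(h_1,h_2-1)+c\gamma_X(h_1-1,h_2-1)$$ for all integers $h_1,h_2$ with $\max(h_1,h_2)>0$.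
   Context: All random variables are real-valued. A random field is wide-sense stationary if it has finite second moments, constant mean, and $\operatorname{cov}(X_{i,j},X_{i-h_1,j-h_2})$ depends only on $(h_1,h_2)$; its autocovariance function is $\gamma_X(h_1,h_2)=\operatorname{cov}(X_{i,j},X_{i-h_1,j-h_2})$. *)

(* Defs.v *)
From HB Require Import structures.
From mathcomp Require Import all_boot all_order all_algebra.
From mathcomp Require Import all_classical all_reals all_analysis.

Set Implicit Arguments.
Unset Strict Implicit.
Unset Printing Implicit Defensive.

Import Order.TTheory GRing.Theory Num.Theory.
Import numFieldNormedType.Exports.

Local Open Scope classical_set_scope.
Local Open Scope ring_scope.

Definition wide_sense_stationary d (T : measurableType d) (R : realType)
    (P : probability T R) (X : int -> int -> {RV P >-> R}) : Prop :=
  [/\ forall i j : int, (X i j : T -> R) \in Lfun P 2%:E,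
      forall i j i' j' : int, ('E_P[X i j] = 'E_P[X i' j'])%E
    & forall i j i' j' h1 h2 : int,
        covariance P (X i j) (X (i - h1) (j - h2)) =
        covariance P (X i' j') (X (i' - h1) (j' - h2))].

Definition white_noise d (T : measurableType d) (R : realType)
    (P : probability T R) (e : int -> int -> {RV P >-> R}) (s2 : R) : Prop :=
  [/\ forall i j : int, (e i j : T -> R) \in Lfun P 2%:E,
      forall i j : int, ('E_P[e i j] = 0)%E,
      forall i j : int, ('V_P[e i j] = s2%:E)%E
    & forall i j k l : int, (i, j) != (k, l) ->
        (covariance P (e i j) (e k l) = 0)%E].

(* The base point (0, 0) and the use of [fine] are immaterial for a wide-sense
   stationary field: see [autocovarianceE]. *)
Definition autocovariance d (T : measurableType d) (R : realType)
    (P : probability T R) (X : int -> int -> {RV P >-> R}) (h1 h2 : int) : R :=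
  fine (covariance P (X 0 0) (X (0 - h1) (0 - h2))).

Lemma autocovarianceE d (T : measurableType d) (R : realType)
    (P : probability T R) (X : int -> int -> {RV P >-> R}) (i j h1 h2 : int) :
  wide_sense_stationary X ->
  covariance P (X i j) (X (i - h1) (j - h2)) = (autocovariance X h1 h2)%:E.
Proof.
case=> X2 _ Xcov; rewrite (Xcov i j 0 0) /autocovariance fineK //.
have L1 k l : (X k l : T -> R) \in Lfun P 1.
  by apply: Lfun_subset12 (X2 k l); rewrite fin_num_measure.
by rewrite covariance_fin_num// Lfun2_mul_Lfun1.
Qed.

(* Main.v *)
(** Fix [(k, l)]. The function [f i j = cov (X i j, eps k l)] is bounded and solves
[f i j = a f (i-1) j + b f i (j-1) + c f (i-1) (j-1)] on the half-plane [i < k]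
(and, symmetrically, on [j < l]), so it suffices that bounded solutions vanish
there. Looking into the past, [F m n = f (i - m) (j - n)], the four inequalities on
[a, b, c] give [mu > 0] and [t < 1] such that the energies
[p m n = (F m n - b F m (n+1))^2] and [q m n = mu (F (m+1) n)^2] satisfy
[p m n + q m n <= t (p (m+1) n + q m (n+1))]. Summed over the antidiagonal
[m + n = N], this bounds the energy on antidiagonal [N] by [t] times that on
antidiagonal [N + 1]; as these grow at most linearly, they are zero. In
particular [F 0 n = b F 0 (n+1)], and [|b| < 1] gives [F 0 0 = 0]. The Yule-Walker
equations follow by bilinearity of the covariance. *)

Require Import Defs.
From mathcomp Require Import all_boot all_order all_algebra.
From mathcomp Require Import all_classical all_reals all_analysis measurable_realfun.
From mathcomp Require Import ring lra zify.

Set Implicit Arguments.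
Unset Strict Implicit.
Unset Printing Implicit Defensive.

Import Order.TTheory GRing.Theory Num.Theory.
Import numFieldNormedType.Exports.

Local Open Scope classical_set_scope.
Local Open Scope ring_scope.

(** * Scalar estimates *)

(** Iteration gives [D 0 <= t ^ n * D n <= C * (n + 1) * t ^ n], and the last expression tends to
    0. *)
Lemma linear_growth_contraction_le0 (R : realType) (D : nat -> R) (t C : R) :
  0 <= t < 1 -> (forall n, D n <= t * D n.+1) -> (forall n, D n <= C * n.+1%:R) ->
  D 0%N <= 0.
Proof.
move=> /andP[t0 t1] Dt DC.
(* By AM-GM [t <= y ^ 2], so that [y ^ n] remains to spare once [y ^ n]
   has absorbed the factor [n + 1]. *)
pose y := (1 + t) / 2.
have y0 : 0 < y by rewrite /y; lra.
have y1 : y < 1 by rewrite /y; lra.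
have ty : t <= y ^+ 2.
  rewrite -subr_ge0; have -> : y ^+ 2 - t = ((1 - t) / 2) ^+ 2 by rewrite /y; field.
  exact: sqr_ge0.
have D0 n : D 0%N <= t ^+ n * D n.
  elim: n => [|n IHn]; first by rewrite expr0 mul1r.
  by rewrite (le_trans IHn)// exprSr -mulrA ler_wpM2l// exprn_ge0.
have C0 : D 0%N <= 0 \/ 0 <= C.
  by have := DC 0%N; rewrite mulr1; case: (lerP 0 C) => *; [right|left; lra].
case: C0 => // C0.
(* As the powers of [y] decrease, [(n + 1) * y ^ n] is at most the geometric sum of [y ^ k] over
   [k <= n]. *)
have ny n : n.+1%:R * y ^+ n <= (1 - y)^-1.
  have := @geometric_le_lim R n.+1 1 y ler01 y0.
  rewrite gtr0_norm// y1 mul1r => /(_ isT); apply: le_trans.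
  rewrite /series/= mulr_natl -[X in _ *+ X]subn0 -sumr_const_nat.
  rewrite !big_nat; apply: ler_sum => k /andP[_]; rewrite ltnS => kn.
  by rewrite mul1r ler_wiXn2l // ltW.
have Dy n : D 0%N <= C / (1 - y) * y ^+ n.
  apply: (le_trans (D0 n)).
  apply: (@le_trans _ _ (y ^+ 2 ^+ n * (C * n.+1%:R))).
    apply: (@le_trans _ _ (t ^+ n * (C * n.+1%:R))).
      by rewrite ler_wpM2l// exprn_ge0.
    by rewrite ler_wpM2r ?mulr_ge0// lerXn2r// ?nnegrE// sqr_ge0.
  have -> : y ^+ 2 ^+ n * (C * n.+1%:R) = C * y ^+ n * (n.+1%:R * y ^+ n).
    by rewrite -exprM mulnC muln2 -addnn exprD; ring.
  by rewrite [leRHS]mulrAC ler_wpM2l// mulr_ge0// exprn_ge0// ltW.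
have := @cvg_geometric R (C / (1 - y)) y.
rewrite gtr0_norm// => /(_ y1) cvy.
rewrite -(cvg_lim _ cvy)//; apply: limr_ge; first by apply/cvg_ex; exists 0.
by apply: nearW => n; exact: Dy.
Qed.

(* By the recurrence, [u = F (m+1) n] and [v = F (m+1) (n+1)] turn
   [(a u + c v)^2] into [(F m n - b F m (n+1))^2]. *)
Lemma quarter_plane_energy (R : realType) (a b c : R)
    (h1 : 0 < 1 - a - b - c) (h2 : 0 < 1 - a + b + c)
    (h3 : 0 < 1 + a - b + c) (h4 : 0 < 1 + a + b - c) :
  exists mu t : R, [/\ 0 < mu, 0 <= t < 1 & forall u v : R,
    (a * u + c * v) ^+ 2 + mu * u ^+ 2 <= t * ((u - b * v) ^+ 2 + mu * v ^+ 2)].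
Proof.
have b1 : b < 1 by lra.
have b2 : -1 < b by lra.
pose mu := (1 + c ^+ 2 - a ^+ 2 - b ^+ 2) / 2.
pose p := (1 + b ^+ 2 - a ^+ 2 - c ^+ 2) / 2.
pose h := b + a * c.
(* With [hi] standing for the positive quantity in each hypothesis, [h1 * h4 + h2 * h3 = 4 * mu],
   [h1 * h3 = 2 * (p - h)] and [h2 * h4 = 2 * (p + h)]. *)
have mu0 : 0 < mu.
  have e1 := mulr_gt0 h1 h4; have e2 := mulr_gt0 h2 h3.
  by rewrite /mu; nra.
have ph1 : 0 < p - h.
  by have e1 := mulr_gt0 h1 h3; rewrite /p /h; nra.
have ph2 : 0 < p + h.
  by have e1 := mulr_gt0 h2 h4; rewrite /p /h; nra.
have mu1 : mu <= 1.
  have c1 : c < 1 by lra.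
  have c2 : -1 < c by lra.
  by rewrite /mu; nra.
have p1 : p <= 1 by rewrite /p; nra.
(* The smaller eigenvalue of the quadratic form [p * (u ^ 2 + v ^ 2) - 2 * h * u * v]. *)
pose del := Num.min (p - h) (p + h).
have del0 : 0 < del by rewrite lt_min ph1 ph2.
have delm : del <= p - h by rewrite ge_min lexx.
have delp : del <= p + h by rewrite ge_min lexx orbT.
(* The two energies differ by at least [del * (u ^ 2 + v ^ 2)], and the larger is at most
   [3 * (u ^ 2 + v ^ 2)]; moreover [del <= p <= 1]. *)
exists mu, (1 - del / 3); split => //; first by lra.
move=> u v.
(* This choice of [mu] makes the coefficients of [u^2] and [v^2] in the
   difference equal. *)
have E : (u - b * v) ^+ 2 + mu * v ^+ 2 - ((a * u + c * v) ^+ 2 + mu * u ^+ 2)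
   = p * (u ^+ 2 + v ^+ 2) - 2 * h * u * v.
  by rewrite /mu /p /h; field.
have S : del * (u ^+ 2 + v ^+ 2) <= p * (u ^+ 2 + v ^+ 2) - 2 * h * u * v.
  have e1 : 0 <= (p - h - del) * (u + v) ^+ 2 by rewrite mulr_ge0 ?sqr_ge0//; lra.
  have e2 : 0 <= (p + h - del) * (u - v) ^+ 2 by rewrite mulr_ge0 ?sqr_ge0//; lra.
  nra.
have B : (u - b * v) ^+ 2 + mu * v ^+ 2 <= 3 * (u ^+ 2 + v ^+ 2).
  have e1 : 0 <= (b * u + v) ^+ 2 by exact: sqr_ge0.
  have e2 : 0 <= (1 - b ^+ 2) * (u ^+ 2 + v ^+ 2).
    by apply: mulr_ge0; [nra|rewrite addr_ge0// sqr_ge0].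
  have e3 : 0 <= (1 - mu) * v ^+ 2 by rewrite mulr_ge0 ?sqr_ge0//; lra.
  have := sqr_ge0 u; nra.
have := ler_wpM2l (ltW del0) B; lra.
Qed.

(** * Bounded solutions of the recurrence *)

Section BoundedQuarterPlane.
Variables (R : realType) (a b c M : R).
Hypotheses (h1 : 0 < 1 - a - b - c) (h2 : 0 < 1 - a + b + c).
Hypotheses (h3 : 0 < 1 + a - b + c) (h4 : 0 < 1 + a + b - c).

Lemma bounded_quarter_plane_col0 (F : nat -> nat -> R) :
  (forall m n, `|F m n| <= M) ->
  (forall m n, F m n = a * F m.+1 n + b * F m n.+1 + c * F m.+1 n.+1) ->
  F 0%N 0%N = b * F 0%N 1%N.
Proof.
move=> FM FE.
have [mu [t [mu0 t01 energy]]] := @quarter_plane_energy R a b c h1 h2 h3 h4.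
have Fsq m n : F m n ^+ 2 <= M ^+ 2.
  by rewrite -[F m n ^+ 2]real_normK ?num_real// lerXn2r ?nnegrE// (le_trans _ (FM m n)).
pose p m n := (F m n - b * F m n.+1) ^+ 2.
pose q m n := mu * F m.+1 n ^+ 2.
have pqt m n : p m n + q m n <= t * (p m.+1 n + q m n.+1).
  rewrite /p (_ : F m n - b * F m n.+1 = a * F m.+1 n + c * F m.+1 n.+1).
    exact: energy.
  by rewrite {1}FE; ring.
have t0 : 0 <= t by case/andP: t01.
pose D n := \sum_(m < n.+1) (p m (n - m)%N + q m (n - m)%N).
(* [D 0] is the sum of the nonnegative [p 0 0] and [q 0 0], so this forces [p 0 0 = 0]. *)
suff : D 0%N <= 0.
  rewrite /D big_ord1/= subn0 => D0; apply/eqP; rewrite -subr_eq0 -sqrf_eq0.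
  rewrite -/(p 0%N 0%N) eq_le sqr_ge0 andbT (le_trans _ D0)// lerDl.
  by rewrite mulr_ge0 ?sqr_ge0// ltW.
apply: (@linear_growth_contraction_le0 R D t (2 * M ^+ 2 * (1 + b ^+ 2) + mu * M ^+ 2)) => // n.
  rewrite /D mulr_sumr.
  apply: (@le_trans _ _ (\sum_(m < n.+1) (t * p m.+1 (n - m)%N + t * q m (n - m).+1))).
    by apply: ler_sum => m _; rewrite -mulrDr.
  under [leRHS]eq_bigr do rewrite mulrDr.
  (* Antidiagonal [n + 1] has one further nonnegative term in each sum, [p 0 (n + 1)] and
     [q (n + 1) 0], which is dropped. *)
  rewrite !big_split/=; apply: lerD.
    rewrite [leRHS]big_ord_recl/=; apply: ler_wpDl.
      by rewrite mulr_ge0// sqr_ge0.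
    by apply: ler_sum => m _; rewrite /bump/= add1n subSS.
  rewrite [leRHS]big_ord_recr/=; apply: ler_wpDr.
    by rewrite mulr_ge0// mulr_ge0 ?sqr_ge0// ltW.
  by apply: ler_sum => m _; rewrite subSn// -ltnS.
(* Each of the [n + 1] terms is bounded through [(u - b * v) ^ 2 <= (1 + b ^ 2) * (u ^ 2 + v ^
   2)]. *)
rewrite mulr_natr -[X in _ *+ X]card_ord -sumr_const.
apply: ler_sum => m _; rewrite /p /q.
apply: lerD; last by rewrite ler_wpM2l// ltW.
move: (n - m)%N => k.
have := Fsq m k; have := Fsq m k.+1; set u := F _ k; set v := F _ _ => Hv Hu.
have e1 : 0 <= (1 + b ^+ 2) * (M ^+ 2 - u ^+ 2).
  by rewrite mulr_ge0 ?subr_ge0// addr_ge0// sqr_ge0.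
have e2 : 0 <= (1 + b ^+ 2) * (M ^+ 2 - v ^+ 2).
  by rewrite mulr_ge0 ?subr_ge0// addr_ge0// sqr_ge0.
have := sqr_ge0 (b * u + v); lra.
Qed.

(** Shifting the quadrant along its first column gives a contraction of ratio [|b|] there; adding
    the hypotheses in pairs gives [|b| < 1]. *)
Lemma bounded_quarter_plane_eq0 (F : nat -> nat -> R) :
  (forall m n, `|F m n| <= M) ->
  (forall m n, F m n = a * F m.+1 n + b * F m n.+1 + c * F m.+1 n.+1) ->
  F 0%N 0%N = 0.
Proof.
move=> FM FE.
have F0 n : F 0%N n = b * F 0%N n.+1.
  exact: (@bounded_quarter_plane_col0 (fun i j => F i (j + n)%N)).
have M0 : 0 <= M by rewrite (le_trans _ (FM 0%N 0%N)).
apply/eqP; rewrite -normr_eq0 eq_le normr_ge0 andbT.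
apply: (@linear_growth_contraction_le0 R (fun n => `|F 0%N n|) `|b| M) => [|n|n].
- have e1 := addr_gt0 h1 h3; have e2 := addr_gt0 h2 h4.
  by rewrite normr_ge0 ltr_norml; apply/andP; split; lra.
- by rewrite {1}F0 normrM.
- by rewrite (le_trans (FM 0%N n))// ler_peMr// ler1n.
Qed.

(** The quadrant behind a point with [i < k] stays in the half-plane, so the recurrence holds on all
    of it. *)
Lemma bounded_half_plane_eq0 (f : int -> int -> R) (k : int) :
  (forall i j, `|f i j| <= M) ->
  (forall i j, i < k ->
    f i j = a * f (i - 1) j + b * f i (j - 1) + c * f (i - 1) (j - 1)) ->
  forall i j, i < k -> f i j = 0.
Proof.
move=> fM fE i j ik.
have := @bounded_quarter_plane_eq0 (fun m n => f (i - m%:Z) (j - n%:Z)).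
rewrite /= !subr0; apply=> // m n.
have e (x : int) (l : nat) : x - l.+1%:Z = x - l%:Z - 1 by lia.
by rewrite (e i) (e j); apply: fE; lia.
Qed.

End BoundedQuarterPlane.

(** * Covariances of square-integrable variables *)

Section Covariance.
Context d (T : measurableType d) (R : realType) (P : probability T R).
Implicit Types X Y Z : T -> R.

Lemma expectation_ae_eq X Y : measurable_fun setT X -> measurable_fun setT Y ->
  {ae P, forall w, X w = Y w} -> ('E_P[X] = 'E_P[Y])%E.
Proof.
move=> mX mY XY; rewrite unlock; apply: ae_eq_integral => //.
- exact/measurable_EFinP.
- exact/measurable_EFinP.
- by apply: filterS XY => w /= ->.
Qed.

(** Lets the right-hand side of the model equation, which holds only almost surely, replace [X i j]
    in a covariance. *)
Lemma covariance_ae_eql X Y Z : measurable_fun setT X -> measurable_fun setT Y ->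
  measurable_fun setT Z -> {ae P, forall w, X w = Y w} ->
  covariance P X Z = covariance P Y Z.
Proof.
move=> mX mY mZ XY; rewrite unlock (expectation_ae_eq mX mY XY).
apply: expectation_ae_eq; last by apply: filterS XY => w XYw; rewrite !fctE/= XYw.
- by apply: measurable_funM; apply: measurable_funB.
- by apply: measurable_funM; apply: measurable_funB.
Qed.

Lemma covariance_fin_num2 X Y : X \in Lfun P 2%:E -> Y \in Lfun P 2%:E ->
  covariance P X Y \is a fin_num.
Proof.
have L1 := Lfun_subset12 (fin_num_measure P _ measurableT).
by move=> X2 Y2; rewrite covariance_fin_num ?Lfun2_mul_Lfun1// L1.
Qed.

Lemma covarianceZl2 r X Y : X \in Lfun P 2%:E -> Y \in Lfun P 2%:E ->
  (covariance P (r \o* X) Y = r%:E * covariance P X Y)%E.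
Proof.
have L1 := Lfun_subset12 (fin_num_measure P _ measurableT).
by move=> X2 Y2; rewrite covarianceZl ?Lfun2_mul_Lfun1// L1.
Qed.

(** The variances of [X + Y] and [X - Y] are nonnegative. *)
Lemma normr_covariance_le X Y : X \in Lfun P 2%:E -> Y \in Lfun P 2%:E ->
  `|fine (covariance P X Y)| <= fine ('V_P[X])%E + fine ('V_P[Y])%E.
Proof.
move=> X2 Y2.
have fX := variance_fin_num X2; have fY := variance_fin_num Y2.
have fXY := covariance_fin_num2 X2 Y2.
have X0 : 0 <= fine ('V_P[X])%E by rewrite fine_ge0// variance_ge0.
have Y0 : 0 <= fine ('V_P[Y])%E by rewrite fine_ge0// variance_ge0.
have := variance_ge0 P (X \+ Y); rewrite varianceD//.
have := variance_ge0 P (X \- Y); rewrite varianceB//.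
rewrite -(fineK fX) -(fineK fY) -(fineK fXY) -EFinM -!EFinD -?EFinN -?EFinD !lee_fin.
by move=> ? ?; rewrite ler_norml; apply/andP; split; lra.
Qed.

End Covariance.

(** * Covariances of the field with the noise *)

Section SpatialAR.
Context d (T : measurableType d) (R : realType) (P : probability T R).
Variables (a b c : R) (X eps : int -> int -> {RV P >-> R}) (sigma2 : R).
Hypotheses (hX : wide_sense_stationary X) (heps : white_noise eps sigma2).
Hypothesis heq : forall i j : int, {ae P, forall w : T,
  X i j w = a * X (i - 1) j w + b * X i (j - 1) w
            + c * X (i - 1) (j - 1) w + eps i j w}.

Let X2 i j : (X i j : T -> R) \in Lfun P 2%:E.
Proof. by case: hX. Qed.

Let eps2 i j : (eps i j : T -> R) \in Lfun P 2%:E.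
Proof. by case: heps. Qed.

(** Serves twice: [Z] a noise variable gives the recurrence for [cov], [Z] a value of the field
    gives the Yule-Walker equations. *)
Lemma covariance_regression i j (Z : {RV P >-> R}) :
  (Z : T -> R) \in Lfun P 2%:E ->
  fine (covariance P (X i j) Z) =
    a * fine (covariance P (X (i - 1) j) Z)
    + b * fine (covariance P (X i (j - 1)) Z)
    + c * fine (covariance P (X (i - 1) (j - 1)) Z)
    + fine (covariance P (eps i j) Z).
Proof.
move=> Z2.
pose Y : T -> R := (a \o* X (i - 1) j \+ b \o* X i (j - 1)
  \+ c \o* X (i - 1) (j - 1) \+ eps i j)%R.
have aX (r : R) k l : r \o* X k l \in Lfun P 2%:E.
  by apply: Lfun_scale => //; rewrite ler1n.
have L2D (U V : T -> R) : U \in Lfun P 2%:E -> V \in Lfun P 2%:E ->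
    U \+ V \in Lfun P 2%:E by move=> U2 V2; rewrite rpredD ?lee1n.
have Y2 : Y \in Lfun P 2%:E by rewrite /Y !L2D.
have -> : covariance P (X i j) Z = covariance P Y Z.
  apply: covariance_ae_eql => //.
  by apply: filterS (heq i j) => w; rewrite /Y/= !(mulrC (X _ _ _)).
rewrite /Y !covarianceDl ?L2D// !covarianceZl2//.
by rewrite !fineD ?fin_numD ?fin_numM ?covariance_fin_num2// !fineM ?covariance_fin_num2.
Qed.

Let cov i j k l : R := fine (covariance P (X i j) (eps k l)).

(** Stationarity and equal noise variances make the sum of the two variances the same at all
    positions. *)
Lemma cov_innovation_bounded : exists M, forall i j k l, `|cov i j k l| <= M.
Proof.
exists (autocovariance X 0 0 + sigma2) => i j k l.
rewrite (le_trans (normr_covariance_le (X2 i j) (eps2 k l)))//.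
have [_ _ -> _] := heps.
have := autocovarianceE i j 0 0 hX; rewrite !subr0 => E.
by rewrite /variance E.
Qed.

Lemma cov_innovation_eq i j k l : (i, j) != (k, l) ->
  cov i j k l = a * cov (i - 1) j k l + b * cov i (j - 1) k l
                + c * cov (i - 1) (j - 1) k l.
Proof.
by move=> ijkl; have [_ _ _ e0] := heps; rewrite /cov covariance_regression// e0// addr0.
Qed.

Hypotheses (h1 : 0 < 1 - a - b - c) (h2 : 0 < 1 - a + b + c).
Hypotheses (h3 : 0 < 1 + a - b + c) (h4 : 0 < 1 + a + b - c).

Lemma cov_innovation_eq0 i j k l : (i < k) || (j < l) -> cov i j k l = 0.
Proof.
have [M covM] := cov_innovation_bounded.
case/orP => [ik|jl].
  apply: (@bounded_half_plane_eq0 R a b c M h1 h2 h3 h4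
    (fun i j => cov i j k l) k) => // i' j' i'k.
  by apply: cov_innovation_eq; rewrite xpair_eqE lt_eqF.
(* Transposing the plane swaps [a] and [b], hence exchanges the hypotheses [h2] and [h3]. *)
have h2' : 0 < 1 - b + a + c by move: h3; rewrite (addrAC 1).
have h3' : 0 < 1 + b - a + c by move: h2; rewrite (addrAC 1).
have h1' : 0 < 1 - b - a - c by move: h1; rewrite (addrAC 1).
have h4' : 0 < 1 + b + a - c by move: h4; rewrite (addrAC 1).
apply: (@bounded_half_plane_eq0 R b a c M h1' h2' h3' h4'
  (fun j i => cov i j k l) l) => // j' i' j'l.
rewrite cov_innovation_eq; first by rewrite (addrC (a * _)).
by rewrite xpair_eqE (lt_eqF j'l) andbF.
Qed.

End SpatialAR.

Theorem proposition5 (d : measure_display) (T : measurableType d)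
    (R : realType) (P : probability T R)
    (a b c : R)
    (habc1 : 0 < 1 - a - b - c) (habc2 : 0 < 1 - a + b + c)
    (habc3 : 0 < 1 + a - b + c) (habc4 : 0 < 1 + a + b - c)
    (X eps : int -> int -> {RV P >-> R}) (sigma2 : R)
    (hX : wide_sense_stationary X)
    (hsigma2 : 0 < sigma2) (heps : white_noise eps sigma2)
    (heq : forall i j : int, {ae P, forall w : T,
      X i j w = a * X (i - 1) j w + b * X i (j - 1) w
                + c * X (i - 1) (j - 1) w + eps i j w}) :
  [/\ forall i j k l : int, (i < k) || (j < l) ->
        covariance P (X i j) (eps k l) = 0%E,
      autocovariance X 0 0 =
        a * autocovariance X 1 0 + b * autocovariance X 0 1
        + c * autocovariance X 1 1 + sigma2
    & forall h1 h2 : int, 0 < Num.max h1 h2 ->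
        autocovariance X h1 h2 =
          a * autocovariance X (h1 - 1) h2 + b * autocovariance X h1 (h2 - 1)
          + c * autocovariance X (h1 - 1) (h2 - 1)].
Proof.
have [X2 _ _] := hX; have [eps2 _ vareps _] := heps.
have cov0 i j k l : (i < k) || (j < l) -> fine (covariance P (X i j) (eps k l)) = 0.
  exact: (cov_innovation_eq0 hX heps heq).
have gammaE i j h1 h2 : fine (covariance P (X i j) (X (i - h1) (j - h2))) =
    autocovariance X h1 h2 by rewrite autocovarianceE.
(* Both equations are instances of this one; they differ only in the value of the noise term. *)
have YW h1 h2 : autocovariance X h1 h2 =
    a * autocovariance X (h1 - 1) h2 + b * autocovariance X h1 (h2 - 1)
    + c * autocovariance X (h1 - 1) (h2 - 1)
    + fine (covariance P (X (- h1) (- h2)) (eps 0 0)).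
  rewrite -(gammaE 0 0) (covariance_regression hX heps heq)// (covarianceC P (eps 0 0)) !sub0r.
  (* Seen from a base point moved back by 1, the same second variable has its lag reduced by 1. *)
  have e (h : int) : - h = - 1 - (h - 1) by ring.
  rewrite -(gammaE (-1) 0 (h1 - 1)) -(gammaE 0 (-1) h1) -(gammaE (-1) (-1)).
  by rewrite -!e !sub0r.
split=> [i j k l ijkl||h1 h2 h12].
- by rewrite -(fineK (covariance_fin_num2 (X2 i j) (eps2 k l))) cov0.
(* At lag [(0, 0)] the general equation produces negative lags, which evenness of the autocovariance
   turns positive. *)
- have gammaN h1 h2 : autocovariance X (- h1) (- h2) = autocovariance X h1 h2.
    rewrite -(gammaE 0 0) -(gammaE h1 h2) covarianceC !subrr !sub0r !opprK.
    by [].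
  rewrite YW !sub0r -(gammaN 1 0) -(gammaN 0 1) -(gammaN 1 1) oppr0.
  (* Regressing [X 0 0] once more, now against [eps 0 0], leaves only the variance of [eps 0 0],
     since the three earlier field values are uncorrelated with it. *)
  congr (_ + _).
  rewrite (covariance_regression hX heps heq)// !cov0 ?orbT// !mulr0 !add0r.
  by rewrite -/(variance _ _) vareps.
- rewrite YW cov0 ?addr0//.
  by move: h12; rewrite lt_max !oppr_lt0.
Qed.
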